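(* Let $q\ge 2$, $n\ge 2$ and $1\le k\le n-1$ be integers with $k\ge n/2$. Then $$S_1^k(q,n)\le \sum_{d\mid n}\frac{\mu(d)}{n}\,q^{n/d},$$ where the sum is over the positive divisors $d$ of $n$ and $\mu$ is the Möbius function.
   Context: Let $\Sigma$ be a finite alphabet with $q\ge 2$ letters. Two (not necessarily distinct) words $u,v$ over $\Sigma$ have a $t$-overlap if the prefix of $u$ of length $t$ equals the suffix of $v$ of length $t$, or vice versa. A code $C\subseteq\Sigma^n$ ($n\ge 2$) is $(1,k)$-overlap-free if for all $1\le t\le k$ no two (not necessarily distinct) codewords in $C$ have a $t$-overlap. $S_1^k(q,n)$ denotes the maximum size of a $(1,k)$-overlap-free code $C\subseteq\Sigma^n$ with $|\Sigma|=q$. *)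

(* Defs.v *)
From mathcomp Require Import all_boot all_order all_algebra.

Set Implicit Arguments.
Unset Strict Implicit.
Unset Printing Implicit Defensive.

Import Order.TTheory GRing.Theory Num.Theory.

Section OverlapFree.

Variable Sigma : finType.

(* The suffix of length t of a word w is [drop (size w - t) w]; this reading
   is meaningful only for t at most the lengths of both words. *)
Definition overlap (t : nat) (u v : seq Sigma) : bool :=
  (take t u == drop (size v - t) v) || (take t v == drop (size u - t) u).

Definition overlap_free (k n : nat) (C : {set n.-tuple Sigma}) : bool :=
  [forall u in C, forall v in C,
     forall t : 'I_k.+1, (1 <= t) ==> ~~ overlap t u v].

End OverlapFree.

(* The maximum ranges over a nonempty family, since the empty code is
   overlap-free; it depends on Sigma only through #|Sigma|. *)
Definition max_overlap_free (Sigma : finType) (k n : nat) : nat :=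
  \max_(C : {set n.-tuple Sigma} | overlap_free k C) #|C|.

(* Intended for d > 0; the value at 0 is irrelevant. *)
Definition moebius (d : nat) : int :=
  if all (fun p => logn p d == 1) (primes d)
  then ((-1) ^+ size (primes d))%R else 0%R.

(* Main.v *)
Require Import Defs.
From mathcomp Require Import all_boot all_order all_algebra.
From mathcomp Require Import zify.

Set Implicit Arguments.
Unset Strict Implicit.
Unset Printing Implicit Defensive.

Import Order.TTheory GRing.Theory Num.Theory.

(** If u = rot s v with 0 < s < n, then u and v overlap both in s and in n - s
    letters, and one of these lengths is at most n/2 <= k.  So the n rotations
    of the words of a (1,k)-overlap-free code are pairwise distinct, and they
    are all primitive: n |C| is at most the number of primitive words.  That
    number is the sum of mu(d) q^(n/d), because the word w is counted in
    the d-th term exactly when d divides n / (least period of w), and the sum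
    of mu over the divisors of m vanishes unless m = 1. *)

Lemma moebius_mul_prime p d : prime p -> 0 < d -> ~~ (p %| d) ->
  moebius (p * d) = (- moebius d)%R.
Proof.
move=> pr_p d_gt0 pNd; have p_gt0 := prime_gt0 pr_p.
have pNprimes : p \notin primes d by rewrite mem_primes pr_p d_gt0.
have perm_primes : perm_eq (primes (p * d)) (p :: primes d).
  apply: uniq_perm => [||x]; rewrite ?primes_uniq //= ?pNprimes ?primes_uniq //.
  by rewrite primesM // inE primes_prime // inE.
have logp : logn p (p * d) == 1.
  by rewrite lognM // logn_prime // eqxx lognE pr_p d_gt0 (negPf pNd).
rewrite /moebius (perm_all _ perm_primes) (perm_size perm_primes) /= logp /=.
have -> : all (fun r => logn r (p * d) == 1) (primes d)
        = all (fun r => logn r d == 1) (primes d).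
  apply: eq_in_all => r r_d; rewrite lognM //.
  rewrite logn_prime //; have [def_r|//] := eqVneq r p.
  by rewrite def_r (negPf pNprimes) in r_d.
by case: ifP => _; rewrite ?oppr0 // exprS mulN1r.
Qed.

Lemma moebius_sqr_dvd p d : prime p -> 0 < d -> p ^ 2 %| d -> moebius d = 0%R.
Proof.
move=> pr_p d_gt0 p2d; rewrite /moebius; case: ifP => // /allP/(_ p).
have p_d : p %| d by apply: dvdn_trans p2d; apply: dvdn_exp.
rewrite mem_primes pr_p d_gt0 p_d => /(_ isT)/eqP log1.
by move: p2d; rewrite pfactor_dvdn // log1.
Qed.

(** For a prime [p] dividing [m], the divisors divisible by [p ^ 2] contribute 0. The others pair
    off as [d] and [p * d] with [d] prime to [p], and the two terms of each pair cancel. *)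
Lemma sum_moebius m : 0 < m ->
  (\sum_(d <- divisors m) moebius d = (m == 1%N)%:R :> int)%R.
Proof.
move=> m_gt0; have [->|m_neq1] := eqVneq m 1.
  by rewrite big_cons big_nil addr0.
set p := pdiv m; have pr_p : prime p by apply: pdiv_prime; lia.
have p_m : p %| m := pdiv_dvd m.
have p_gt0 := prime_gt0 pr_p.
rewrite (bigID (fun d => p %| d)) /= (bigID (fun d => p ^ 2 %| d)) /=.
rewrite big_seq_cond big1 ?add0r; last first.
  move=> d /and3P[]; rewrite -dvdn_divisors // => d_m _.
  by apply: moebius_sqr_dvd => //; apply: dvdn_gt0 d_m.
rewrite -big_filter -[X in (_ + X)%R]big_filter.
(* [s] lists the divisors of [m] that are prime to [p]; multiplication by [p] carries it onto those
   divisible by [p] exactly once. *)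
set s := [seq d <- _ | ~~ _].
have -> : (\sum_(d <- [seq i <- divisors m | (p %| i)%N && ~~ (p ^ 2 %| i)%N])
    moebius d = \sum_(d <- [seq (p * d)%N | d <- s]) moebius d)%R.
  apply: perm_big; apply: uniq_perm.
  - by rewrite filter_uniq // divisors_uniq.
  - rewrite map_inj_uniq ?filter_uniq ?divisors_uniq // => x y /eqP.
    by rewrite eqn_pmul2l // => /eqP.
  move=> d; rewrite mem_filter -dvdn_divisors //.
  apply/andP/mapP => [[/andP[/dvdnP[e ->] pNe] e_m]|[e]].
    exists e; last by rewrite mulnC.
    rewrite mem_filter -dvdn_divisors //.
    rewrite (dvdn_trans _ e_m) ?dvdn_mulr // andbT.
    by move: pNe; rewrite expnS expn1 dvdn_pmul2r.
  rewrite mem_filter -dvdn_divisors // => /andP[pNe e_m] ->.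
  rewrite dvdn_mulr //= expnS expn1 dvdn_pmul2l //; split=> //.
  by rewrite Gauss_dvd ?p_m // prime_coprime.
rewrite big_map -big_split big_seq big1 //= => d.
rewrite mem_filter -dvdn_divisors // => /andP[pNd d_m].
by rewrite moebius_mul_prime ?addNr // (dvdn_gt0 _ d_m).
Qed.

(** Take for [p] the least positive period of [x]: if [j] is a period, so is [j %% p], which
    minimality forces to be 0. *)
Lemma iter_fix_dvdn (T : eqType) (f : T -> T) (x : T) n :
    0 < n -> iter n f x = x ->
  exists2 p, 0 < p & forall j, (iter j f x == x) = (p %| j).
Proof.
move=> n_gt0 fix_n.
have ex_p : exists p, (0 < p) && (iter p f x == x).
  by exists n; rewrite n_gt0 fix_n eqxx.
case: (ex_minnP ex_p) => p /andP[p_gt0 /eqP fix_p] min_p; exists p => // j.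
have fix_mul i : iter (i * p) f x = x.
  by elim: i => // i IH; rewrite mulSn iterD IH.
rewrite {1}(divn_eq j p) addnC iterD fix_mul.
apply/eqP/eqP => [fix_r|-> //]; apply/eqP; rewrite -leqn0 leqNgt.
apply/negP => r_gt0; have := min_p (j %% p).
by rewrite r_gt0 fix_r eqxx leqNgt ltn_pmod // => /(_ isT).
Qed.

(** The bound on [j] matters: beyond [size w], [rot j w] stays equal to [w], while the iteration
    keeps turning. *)
Lemma iter_rot1 (T : Type) (w : seq T) j :
  j <= size w -> iter j (rot 1) w = rot j w.
Proof.
elim: j => [|j IH] j_le; first by rewrite rot0.
by rewrite iterS IH 1?ltnW // -rotS.
Qed.

Lemma rot_period (T : eqType) (w : seq T) : 0 < size w ->
  exists2 p, 0 < p &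
    forall j, j <= size w -> (rot j w == w) = (p %| j).
Proof.
move=> w_gt0.
have [||p p_gt0 pP] := @iter_fix_dvdn _ (rot 1) w (size w) => //.
  by rewrite iter_rot1 ?rot_size.
by exists p => // j j_le; rewrite -pP iter_rot1.
Qed.

Section Words.

Variable T : finType.

(** For [n > 0] this is the usual notion of a word that is not a proper power. *)
Definition primitive n (w : n.-tuple T) : bool :=
  [forall j : 'I_n, (0 < j) ==> (rot j w != w :> seq T)].

Lemma sum_moebius_fix n (w : n.-tuple T) : 0 < n ->
  (\sum_(d <- divisors n | rot (n %/ d) w == w :> seq T) moebius d
   = (primitive w)%:R :> int)%R.
Proof.
move=> n_gt0; have [|p p_gt0] := @rot_period _ w; rewrite size_tuple // => pP.
have p_n : p %| n by rewrite -pP // -{1}(size_tuple w) rot_size.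
have -> : primitive w = (n %/ p == 1).
  rewrite -(eqn_pmul2r p_gt0) mul1n divnK //.
  apply/forallP/eqP => [prim_w|def_n j].
    have := dvdn_leq n_gt0 p_n; rewrite leq_eqVlt => /predU1P[//|p_lt].
    by have := prim_w (Ordinal p_lt); rewrite /= p_gt0 pP ?dvdnn // ltnW.
  apply/implyP => j_gt0; rewrite pP ?(ltnW (ltn_ord j)) //.
  by rewrite -def_n gtnNdvd.
have np_gt0 : 0 < n %/ p by rewrite divn_gt0 ?(dvdn_leq n_gt0 p_n).
(* For [d] dividing [n], [p] divides [n %/ d] exactly when [d] divides [n %/ p], so both sums have
   the same range. *)
rewrite -sum_moebius // -big_filter.
apply: perm_big; apply: uniq_perm; rewrite ?filter_uniq ?divisors_uniq //.
move=> d; rewrite mem_filter pP ?leq_div // -!dvdn_divisors //.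
rewrite [RHS]dvdn_divRL //; apply/andP/idP => [[pd d_n]|dp].
  by move: pd; rewrite dvdn_divRL // mulnC.
have d_n : d %| n by apply: dvdn_trans dp; apply: dvdn_mulr.
by rewrite dvdn_divRL // mulnC.
Qed.

(** Commutation makes [s] a prefix of [y]; once it is removed, the rest of [y] still commutes with
    [s]. *)
Lemma cat_comm_flatten (s y : seq T) m : size y = m * size s ->
  y ++ s = s ++ y -> y = flatten (nseq m s).
Proof.
elim: m y => [|m IH] y /=; first by move/size0nil.
rewrite mulSn => size_y comm.
have def_y : y = s ++ drop (size s) y.
  rewrite -{1}(cat_take_drop (size s) y); congr (_ ++ _).
  by have := congr1 (take (size s)) comm; rewrite takel_cat ?take_size_cat //; lia.
rewrite {1}def_y; congr (_ ++ _); apply: IH; first by rewrite size_drop; lia.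
by move/eqP: comm; rewrite {1 2}def_y -catA eqseq_cat // eqxx /= => /eqP.
Qed.

Lemma flatten_nseq_comm (s : seq T) m :
  flatten (nseq m s) ++ s = s ++ flatten (nseq m s).
Proof. by elim: m => [|m IH] /=; rewrite ?cats0 // -catA IH. Qed.

Lemma size_flatten_nseq (s : seq T) m : size (flatten (nseq m s)) = m * size s.
Proof. by elim: m => //= m IH; rewrite size_cat IH mulSn. Qed.

(** The fixed words are the powers of words of length [e], and such a power determines its base
    through its first [e] letters. *)
Lemma card_rot_fix n e : 0 < n -> e %| n ->
  #|[set w : n.-tuple T | rot e w == w :> seq T]| = #|T| ^ e.
Proof.
move=> n_gt0 /dvdnP[m def_n].
have size_pow (s : e.-tuple T) : size (flatten (nseq m (tval s))) == n.
  by rewrite size_flatten_nseq size_tuple def_n.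
pose pow (s : e.-tuple T) := Tuple (size_pow s).
case: m def_n => [|m] def_n in size_pow pow *; first by rewrite def_n in n_gt0.
have pow_inj : injective pow.
  move=> s t /(congr1 (fun w : n.-tuple T => take e w)) /=.
  by rewrite !take_size_cat ?size_tuple // => /val_inj.
rewrite -card_tuple -(card_imset _ pow_inj); apply: eq_card => w.
rewrite inE; apply/eqP/imsetP => [fix_w|[s _ ->]]; last first.
  by rewrite /= -{1}(size_tuple s) rot_size_cat flatten_nseq_comm.
have size_take_w : size (take e w) == e.
  by rewrite size_takel // size_tuple def_n leq_pmull.
exists (Tuple size_take_w) => //; apply: val_inj => /=.
(* [fix_w] says that [take e w] and [drop e w] commute, so the latter is a power of the former. *)
rewrite -[LHS](cat_take_drop e w); congr (_ ++ _).
apply: cat_comm_flatten.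
  by rewrite (eqP size_take_w) size_drop size_tuple def_n mulSn addKn.
by rewrite cat_take_drop.
Qed.

Lemma card_primitive n : 0 < n ->
  (#|[set w : n.-tuple T | primitive w]|%:R
   = \sum_(d <- divisors n) moebius d * (#|T| ^ (n %/ d))%:R :> int)%R.
Proof.
move=> n_gt0; rewrite -sum1_card natr_sum big_mkcond /=.
transitivity (\sum_(w : n.-tuple T)
    \sum_(d <- divisors n | rot (n %/ d) w == w :> seq T) moebius d)%R.
  apply: eq_bigr => w _; rewrite sum_moebius_fix // inE.
  by case: ifP.
rewrite (exchange_big_dep predT) //= big_seq [RHS]big_seq; apply: eq_bigr => d.
rewrite -dvdn_divisors // => d_n; rewrite -(@card_rot_fix n) //; last first.
  by apply/dvdnP; exists d; rewrite mulnC divnK.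
rewrite -sum1_card natr_sum mulr_sumr.
by apply: eq_big => [w|w _]; rewrite ?inE ?mulr1.
Qed.

(** Write [v = x ++ y] with [x] of length [s], so [u = y ++ x]. Then [x] is an overlap of length [s]
    and [y] one of length [n - s]; if [s > k], then [n - s <= k]. *)
Lemma overlap_rot k n s (u v : n.-tuple T) : n <= 2 * k -> 0 < s < n ->
  u = rot s v :> seq T -> exists2 t, 0 < t <= k & overlap t u v.
Proof.
move=> n_le /andP[s_gt0 s_lt] def_u.
have [s_le|s_gt] := leqP s k.
  exists s; first by rewrite s_gt0.
  apply/orP; right; rewrite def_u size_rot !size_tuple /rot.
  by rewrite drop_size_cat // size_drop size_tuple.
exists (n - s); first by lia.
apply/orP; left; rewrite def_u size_tuple subKn ?(ltnW s_lt) // /rot.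
by rewrite take_size_cat // size_drop size_tuple.
Qed.

Lemma overlap_free_rot k n s (C : {set n.-tuple T}) (u v : n.-tuple T) :
    n <= 2 * k -> overlap_free k C -> u \in C -> v \in C -> s < n ->
  u = rot s v :> seq T -> s = 0.
Proof.
move=> n_le freeC Cu Cv s_lt def_u; case: (posnP s) => // s_gt0.
have s_bnd : 0 < s < n by rewrite s_gt0.
have [t /andP[t_gt0 t_le] ov] := overlap_rot n_le s_bnd def_u.
have /forallP/(_ u)/implyP/(_ Cu)/forallP/(_ v)/implyP/(_ Cv) := freeC.
by move=> /forallP/(_ (inord t)); rewrite inordK // t_gt0 ov.
Qed.

Lemma overlap_free_rot_inj k n (C : {set n.-tuple T}) (u v : n.-tuple T) i j :
    n <= 2 * k -> overlap_free k C -> u \in C -> v \in C -> i <= j < n ->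
  rot i u = rot j v -> u = v /\ i = j.
Proof.
move=> n_le freeC Cu Cv /andP[i_le j_lt] eq_rot.
(* Undoing the rotation by [i] leaves a single rotation between two codewords. *)
have def_u : u = rot (j - i) v :> seq T.
  apply: (@rot_inj i); rewrite eq_rot -rotD ?subnKC //.
  by rewrite size_tuple ltnW.
have s_lt : j - i < n by lia.
have s0 := overlap_free_rot n_le freeC Cu Cv s_lt def_u.
split; last by lia.
by apply: val_inj; rewrite /= def_u s0 rot0.
Qed.

Lemma card_overlap_free_primitive k n (C : {set n.-tuple T}) : n <= 2 * k ->
  overlap_free k C -> #|C| * n <= #|[set w : n.-tuple T | primitive w]|.
Proof.
move=> n_le freeC.
pose r (x : n.-tuple T * 'I_n) := [tuple of rot x.2 x.1].
have r_inj : {in setX C [set: 'I_n] &, injective r}.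
  move=> [u i] [v j] /setXP[/= Cu _] /setXP[/= Cv _] /(congr1 val) /= eq_rot.
  have [ij|/ltnW ji] := leqP i j.
    have [|-> /val_inj-> //] := overlap_free_rot_inj n_le freeC Cu Cv _ eq_rot.
    by rewrite ij ltn_ord.
  have [|-> /val_inj-> //] :=
    overlap_free_rot_inj n_le freeC Cv Cu _ (esym eq_rot).
  by rewrite ji ltn_ord.
rewrite -[X in _ * X]card_ord -[#|'I_n|]cardsT -cardsX -(card_in_imset r_inj).
apply: subset_leq_card; apply/subsetP => _ /imsetP[[u i] /setXP[/= Cu _] ->].
rewrite inE; apply/forallP => j; apply/implyP => j_gt0; apply/eqP.
(* Rotations commute, so a rotation fixing [rot i u] also fixes the codeword [u], which would then
   overlap itself. *)
rewrite /= rot_rot => /rot_inj/esym fix_u.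
by rewrite (overlap_free_rot n_le freeC Cu Cu (ltn_ord j) fix_u) in j_gt0.
Qed.

End Words.

Theorem proposition5 (Sigma : finType) (q n k : nat)
  (hSigma : #|Sigma| = q) (hq : 2 <= q) (hn : 2 <= n)
  (hk1 : 1 <= k) (hkn : k <= n - 1) (hnk : n <= 2 * k) :
  ((max_overlap_free Sigma k n)%:R <=
   \sum_(d <- divisors n)
     (moebius d)%:~R / n%:R * q%:R ^+ (n %/ d) :> rat)%R.
Proof.
have n_gt0 : 0 < n by apply: ltnW.
have -> : (\sum_(d <- divisors n)
     (moebius d)%:~R / n%:R * q%:R ^+ (n %/ d)
   = #|[set w : n.-tuple Sigma | primitive w]|%:R / n%:R :> rat)%R.
  rewrite -[(#|_|%:R)%R](rmorph_nat intr) card_primitive // hSigma.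
  rewrite rmorph_sum mulr_suml; apply: eq_bigr => d _ /=.
  by rewrite rmorphM /= rmorph_nat natrX mulrAC.
rewrite ler_pdivlMr ?ltr0n // -natrM ler_nat.
(* Passing to the integer quotient isolates the maximum, so that each code can be bounded
   separately. *)
rewrite -leq_divRL //; apply/bigmax_leqP => C freeC; rewrite leq_divRL //.
exact: card_overlap_free_primitive freeC.
Qed.
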